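(* Let $\lambda$ be an infinite cardinal, let $I$ be a set with $|I| = \lambda$, and let $\mathcal{D}$ be a regular ultrafilter on $I$. If $\mathcal{D}$ is flexible, then $\mu(\mathcal{D}) \geq \lambda^+$, and thus $\mathcal{D}$ saturates every stable theory; that is, for every countable complete first-order stable theory $T$ and every $M \models T$, the ultrapower $M^I/\mathcal{D}$ is $\lambda^+$-saturated.
   Context: Let $|I| = \lambda$. A filter $\mathcal{D}$ on $I$ is regular ($\lambda$-regular) if there is a family $\langle X_i : i < \lambda\rangle$ of members of $\mathcal{D}$ such that $\bigcap_{i \in \sigma} X_i = \emptyset$ for every infinite $\sigma \subseteq \lambda$. A filter $\mathcal{D}$ on $I$ is flexible (i.e. $\lambda$-flexible) if for every $f : I \to \mathbb{N}$ such that $\{t \in I : n < f(t)\} \in \mathcal{D}$ for all $n \in \mathbb{N}$, there are $X_\alpha \in \mathcal{D}$ for $\alpha < \lambda$ such that $f(t) \geq |\{\alpha < \lambda : t \in X_\alpha\}|$ for all $t \in I$. For a regular ultrafilter $\mathcal{D}$ on $I$, $\mu(\mathcal{D})$ is the minimum of the cardinals $\left|\prod_{t \in I} n[t]/\mathcal{D}\right|$ taken over all sequences $\langle n[t] : t \in I\rangle$ of natural numbers (each $n[t]$ viewed as a finite set of $n[t]$ elements) for which $\left|\prod_{t \in I} n[t]/\mathcal{D}\right| \geq \aleph_0$. All languages are countable. *)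

(* Defs.v *)
From mathcomp Require Import all_boot.
From mathcomp Require Import boolp classical_sets functions cardinality filter.

Set Implicit Arguments.
Unset Strict Implicit.
Unset Printing Implicit Defensive.

Local Open Scope classical_set_scope.
Local Open Scope card_scope.

(** * Cardinals

   A cardinal is represented by any set having that cardinality, and cardinals
   are compared through [#<=] and [#=]. *)

Definition card_lt T U (A : set T) (B : set U) : Prop :=
  (A #<= B) /\ ~ (B #<= A).

Definition is_card_succ T U (A : set T) (S : set U) : Prop :=
  card_lt A S /\ forall V (B : set V), card_lt A B -> S #<= B.

Lemma inj_card_leT (T U : Type) (f : T -> U) :
  injective f -> [set: T] #<= [set: U].
Proof.
move=> fI; apply/card_leP/injfunPex.
exists (fun x => exist _ (f (sval x)) (mem_setT _) : [set: U]) => //.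
by move=> [x xP] [y yP] _ _ /(congr1 sval)/= /fI exy; apply: val_inj.
Qed.

(* Among any family of cardinals there is a least one. *)
Lemma card_min (J : Type) (X : J -> Type) (j0 : J) :
  exists j, forall k, [set: X j] #<= [set: X k].
Proof.
pose P (S : set (forall j, X j)) :=
  forall j f g, S f -> S g -> f j = g j -> f = g.
have [F FP Ftot|A [PA Amax]] := @Zorn_bigcup _ P.
  move=> j f g [S FS Sf] [S' FS' S'g].
  have [SS'|S'S] := Ftot _ _ FS FS'.
    exact: (FP _ FS' j f g (SS' _ Sf) S'g).
  exact: (FP _ FS j f g Sf (S'S _ S'g)).
have [[j jsurj]|nosurj] :=
    pselect (exists j, forall x : X j, exists2 f, A f & f j = x).
  have /choice[h hP] : forall x : X j, exists f, A f /\ f j = x.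
    by move=> x; have [f Af fx] := jsurj x; exists f.
  exists j => k; apply: (@inj_card_leT _ _ (fun x => h x k)) => x y hxy.
  have [[Ax hx] [Ay hy]] := (hP x, hP y).
  by rewrite -hx -hy (PA _ _ _ Ax Ay hxy).
have miss j : {x : X j | forall f, A f -> f j <> x}.
  apply: cid; apply: contra_notP nosurj => nx; exists j => x.
  by apply: contra_notP nx => nf; exists x => f Af fx; apply: nf; exists f.
pose g j := sval (miss j).
have gA j f : A f -> f j <> g j by exact: (svalP (miss j)).
case: (Amax (A `|` [set g])).
  split; first by move=> f Af; left.
  by move=> /(_ g (or_intror erefl))/(gA j0); apply.
move=> j f f' [Af|->] [Af'|->] // e; first exact: PA e.
- by case: (gA j f).
- by case: (gA j f').
Qed.

Lemma card_le_total T U (A : set T) (B : set U) : (A #<= B) \/ (B #<= A).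
Proof.
have [j jmin] := @card_min bool (fun b => if b then A : Type else B) true.
have eA := card_setT A; have eB := card_setT B.
case: j jmin => jmin; [left; have := jmin false|right; have := jmin true] => /=.
  by rewrite (card_le_eql eA) (card_le_eqr eB).
by rewrite (card_le_eql eB) (card_le_eqr eA).
Qed.

Lemma card_pow_nle (T : Type) : ~ ([set: set T] #<= [set: T]).
Proof.
move=> /card_leP/injfunPex[f _ fI].
pose F (A : set T) : T := sval (f (exist _ A (mem_setT A))).
have FI : injective F.
  move=> A B /val_inj/fI; rewrite !in_setT => /(_ erefl erefl).
  by move/(congr1 sval).
pose R := [set x | exists2 A, x = F A & ~ A x].
have nR : ~ R (F R) by move=> /[dup] RR [A /FI <-]; apply.
by apply: (nR); exists R.
Qed.

Lemma card_succ_exists (T : Type) :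
  exists S : set (set T), is_card_succ [set: T] S.
Proof.
pose J := {S : set (set T) | ~ (S #<= [set: T])}.
have [[S nST] Smin] := @card_min J (fun j => sval j : Type)
  (exist _ [set: set T] (@card_pow_nle T)).
have {}Smin (A : set (set T)) : ~ (A #<= [set: T]) -> S #<= A.
  move=> nA; have := Smin (exist _ A nA).
  by rewrite (card_le_eql (card_setT S)) (card_le_eqr (card_setT A)).
exists S; split; first by split => //; case: (card_le_total S [set: T]).
move=> V B [_ nBT]; have [BP|PB] := card_le_total B [set: set T]; last first.
  by apply: card_le_trans PB; apply: card_leT.
have /pcard_leP[f] := BP.
have fB : f @` B #= B by exact: card_image.
rewrite -(card_le_eqr fB); apply: Smin.
by rewrite (card_le_eql fB).
Qed.

(* The successor of the cardinal of [T], realised by a set of subsets of [T]. *)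
Definition card_succ (T : Type) : set (set T) :=
  projT1 (cid (card_succ_exists T)).
Arguments card_succ : clear implicits.

Lemma card_succP (T : Type) : is_card_succ [set: T] (card_succ T).
Proof. exact: projT2 (cid (card_succ_exists T)). Qed.

(** * Filters on [I]; [L] is a type of cardinality lambda *)

Definition regular (L I : Type) (D : set_system I) : Prop :=
  exists X : L -> set I, (forall a, D (X a)) /\
    forall s : set L, infinite_set s -> \bigcap_(a in s) X a = set0.

Definition flexible (L I : Type) (D : set_system I) : Prop :=
  forall f : I -> nat, (forall n, D [set t | (n < f t)%N]) ->
  exists X : L -> set I, (forall a, D (X a)) /\
    forall t, [set a | X a t] #<= `I_(f t).

(** * Ultraproducts *)

Definition ultra_eq (I : Type) (D : set_system I) (X : I -> Type)
  (f g : forall t, X t) : Prop := D [set t | f t = g t].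

(* The product of the [X t] modulo [D], as the set of [ultra_eq]-classes. *)
Definition ultraprod (I : Type) (D : set_system I) (X : I -> Type) : Type :=
  {C : set (forall t, X t) | exists f, C = ultra_eq D f}.

Definition ultra_class (I : Type) (D : set_system I) (X : I -> Type)
  (f : forall t, X t) : ultraprod D X :=
  exist _ (ultra_eq D f) (ex_intro _ f erefl).

Definition ultra_repr (I : Type) (D : set_system I) (X : I -> Type)
  (x : ultraprod D X) : forall t, X t := projT1 (cid (svalP x)).

(* The product of the finite sets [{0, ..., n t - 1}] modulo [D]. *)
Definition nat_ultraprod (I : Type) (D : set_system I) (n : I -> nat) : Type :=
  ultraprod D (fun t => 'I_(n t)).

Definition is_mu_seq (I : Type) (D : set_system I) (n : I -> nat) : Prop :=
  [set: nat] #<= [set: nat_ultraprod D n] /\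
  forall m : I -> nat, [set: nat] #<= [set: nat_ultraprod D m] ->
    [set: nat_ultraprod D n] #<= [set: nat_ultraprod D m].

(* If no [nat_ultraprod D n] is infinite, which cannot happen for a regular
   ultrafilter on an infinite set, the sequence is constantly zero and [mu D]
   is a finite cardinal. *)
Definition mu_seq (I : Type) (D : set_system I) : I -> nat :=
  xget (fun=> 0) [set n | is_mu_seq D n].

Definition mu (I : Type) (D : set_system I) : Type :=
  nat_ultraprod D (mu_seq D).

(** * First-order logic (with equality) *)

Record language := Language {
  fsym : Type;
  rsym : Type;
  farity : fsym -> nat;
  rarity : rsym -> nat }.

Definition countable_language (L : language) : Prop :=
  countable [set: fsym L] /\ countable [set: rsym L].

(* [term L n] and [formula L n] have their free variables among ['I_n]; in
   [All phi] the bound variable is the variable [ord0] of [phi], and variable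
   [i] of [All phi] is variable [lift ord0 i] of [phi]. *)
Inductive term (L : language) (n : nat) : Type :=
| Var of 'I_n
| App (f : fsym L) of ('I_(farity f) -> term L n).

Inductive formula (L : language) : nat -> Type :=
| Bot n : formula L n
| Eq n of term L n & term L n : formula L n
| Rel n (r : rsym L) of ('I_(rarity r) -> term L n) : formula L n
| Imp n of formula L n & formula L n : formula L n
| All n of formula L n.+1 : formula L n.

Definition Neg (L : language) n (phi : formula L n) : formula L n :=
  Imp phi (Bot L n).

Record structure (L : language) := Structure {
  carrier :> Type;
  carrier_inh : inhabited carrier;
  finterp : forall f : fsym L, ('I_(farity f) -> carrier) -> carrier;
  rinterp : forall r : rsym L, ('I_(rarity r) -> carrier) -> Prop }.

Definition vcons (M : Type) n (x : M) (v : 'I_n -> M) : 'I_n.+1 -> M :=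
  fun i => if unlift ord0 i is Some j then v j else x.

Definition vcat (M : Type) n m (v : 'I_n -> M) (w : 'I_m -> M) : 'I_(n + m) -> M :=
  fun i => match fintype.split i with inl j => v j | inr k => w k end.

Fixpoint eval (L : language) (M : structure L) n (v : 'I_n -> M)
    (t : term L n) : M :=
  match t with
  | Var i => v i
  | App f ts => finterp (fun i => eval v (ts i))
  end.

Fixpoint sat (L : language) (M : structure L) n (phi : formula L n) :
    ('I_n -> M) -> Prop :=
  match phi with
  | Bot _ => fun=> False
  | Eq _ t1 t2 => fun v => eval v t1 = eval v t2
  | Rel _ _ ts => fun v => rinterp (fun i => eval v (ts i))
  | Imp _ phi psi => fun v => sat phi v -> sat psi v
  | All _ phi => fun v => forall x : M, sat phi (vcons x v)
  end.

(* The quantification over [v] is harmless: ['I_0 -> M] has one element. *)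
Definition holds (L : language) (M : structure L) (phi : formula L 0) : Prop :=
  forall v : 'I_0 -> M, sat phi v.

Definition is_model (L : language) (T : set (formula L 0)) (M : structure L) : Prop :=
  forall phi, T phi -> holds M phi.

Definition entails (L : language) (T : set (formula L 0)) (phi : formula L 0) : Prop :=
  forall M : structure L, is_model T M -> holds M phi.

Definition complete_theory (L : language) (T : set (formula L 0)) : Prop :=
  (exists M : structure L, is_model T M) /\
  forall phi, entails T phi \/ entails T (Neg phi).

(* [phi(x; y)] has [n] variables [x] and [m] variables [y]. *)
Definition order_property (L : language) (T : set (formula L 0)) n m
    (phi : formula L (n + m)) : Prop :=
  exists M : structure L, is_model T M /\
  exists (a : nat -> 'I_n -> M) (b : nat -> 'I_m -> M),
    forall i j, sat phi (vcat (a i) (b j)) <-> (i < j)%N.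

Definition stable (L : language) (T : set (formula L 0)) : Prop :=
  forall n m (phi : formula L (n + m)), ~ order_property T phi.

(** * Types and saturation *)

(* A formula in [n] free variables with parameters in [A]. *)
Record pformula (L : language) (M : structure L) (A : set M) (n : nat) := PFormula {
  pf_nparams : nat;
  pf_formula : formula L (n + pf_nparams);
  pf_params : 'I_pf_nparams -> A }.

Definition pneg (L : language) (M : structure L) (A : set M) n
    (phi : pformula A n) : pformula A n :=
  PFormula (Neg (pf_formula phi)) (pf_params (p := phi)).

Definition psat (L : language) (M : structure L) (A : set M) n
    (phi : pformula A n) (a : 'I_n -> M) : Prop :=
  sat (pf_formula phi) (vcat a (fun i => val (pf_params (p := phi) i))).

(* The complete [n]-types over [A] in [M]. *)
Definition complete_type (L : language) (M : structure L) (A : set M) n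
    (p : set (pformula A n)) : Prop :=
  (forall q : set (pformula A n), finite_set q -> q `<=` p ->
     exists a : 'I_n -> M, forall phi, q phi -> psat phi a) /\
  forall phi, p phi \/ p (pneg phi).

Definition realized (L : language) (M : structure L) (A : set M) n
    (p : set (pformula A n)) : Prop :=
  exists a : 'I_n -> M, forall phi, p phi -> psat phi a.

(* [M] is kappa-saturated, where kappa is the cardinality of [K]. *)
Definition saturated (L : language) (U : Type) (K : set U) (M : structure L) : Prop :=
  forall A : set M, card_lt A K ->
  forall n (p : set (pformula A n)), complete_type p -> realized p.

(** * Ultrapowers *)

(* The interpretations use representatives of the arguments; when [D] is a
   filter they do not depend on the choice of representatives. *)
Definition ultrapower (L : language) (I : Type) (D : set_system I)
    (M : structure L) : structure L := {|
  carrier := ultraprod D (fun=> M);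
  carrier_inh := let: inhabits x := carrier_inh M in
                 inhabits (ultra_class D (fun=> x));
  finterp f xs := ultra_class D (fun t => finterp (fun i => ultra_repr (xs i) t));
  rinterp r xs := D [set t | rinterp (fun i => ultra_repr (xs i) t)] |}.

(* Main.v *)
Require Import Defs.
From mathcomp Require Import all_boot.
From mathcomp Require Import boolp classical_sets functions cardinality filter.

(** The bound on [mu D] is a diagonal argument: if the product of the [n t]
    modulo [D] is infinite and is listed by lambda, flexibility assigns to each
    [t] fewer than [n t] members of the list, and a value below [n t] avoids them.

    For saturation, extend the type [p] over [A] to an ultrafilter [U] of subsets
    of [N^n], where [N] is the ultrapower, and choose [b 0, b 1, ...] in [N^n],
    each satisfying the [U]-large formulas over countably many parameters chosen
    as witnesses for the previous terms. By stability, for each formula [phi]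
    there is [k] such that every [U]-large instance of [phi] fails at no more than
    [k] of the [b i]; neither forking nor definability of types is needed. Hence
    every instance of [phi] either fails or holds at no more than [k] of the [b i],
    which overspills to sequences of length [len (h t)] in the factor [M] at [t],
    with [h] tending to infinity modulo [D]. By flexibility, at most [h t] elements
    of [A] matter at [t], so that the few exceptions of the formulas with index
    below [h t] do not exhaust the sequence; picking a remaining term for each [t]
    realises [p]. *)

Set Implicit Arguments.
Unset Strict Implicit.
Unset Printing Implicit Defensive.

Local Open Scope classical_set_scope.
Local Open Scope card_scope.

(** * Ultraproducts of finite sets *)

Lemma card_le_II_code T (A : set T) k : A #<= `I_k ->
  exists c : T -> nat, (forall x, A x -> (c x < k)%N) /\
    forall x y, A x -> A y -> c x = c y -> x = y.
Proof.
move=> /pcard_leP[c]; exists c; split=> [x Ax|x y Ax Ay cxy].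
  by have := @funS _ _ _ _ c _ Ax.
by apply: (@inj _ _ _ c); rewrite ?inE.
Qed.

Lemma card_leT_inj T U : [set: T] #<= [set: U] -> exists f : T -> U, injective f.
Proof.
move=> /card_leP/injfunPex[f _ fI].
exists (fun x => sval (f (exist _ x (mem_setT x)))) => x y /val_inj/fI.
by rewrite !in_setT => /(_ erefl erefl)/(congr1 sval).
Qed.

Lemma lt_card_succP T V (A : set V) : card_lt A (card_succ T) -> A #<= [set: T].
Proof.
move=> [_ nSA]; have [//|TA] := card_le_total A [set: T].
apply: contrapT => nAT; apply: nSA.
by have [_] := card_succP T; apply; split.
Qed.

Lemma filter_forall_in T (J : eqType) (F : set_system T) (s : seq J) (P : J -> set T) :
  Filter F -> (forall j, j \in s -> F (P j)) ->
  F [set t | forall j, j \in s -> P j t].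
Proof.
move=> FF; elim: s => [_|j s IH FP].
  by apply: filterS filterT => t _ k; rewrite in_nil.
have FPj : F (P j) by apply: FP; rewrite inE eqxx.
have FPs : F [set t | forall j, j \in s -> P j t].
  by apply: IH => k ks; apply: FP; rewrite inE ks orbT.
apply: filterS2 FPj FPs => t Pj Ps k; rewrite inE => /orP[/eqP->//|].
exact: Ps.
Qed.

Lemma ultra_not T (F : set_system T) (A : set T) : UltraFilter F ->
  ~ F A -> F (~` A).
Proof. by move=> FU; case: (in_ultra_setVsetC A FU). Qed.

Lemma ultra_decide T (F : set_system T) (A : set T) : UltraFilter F ->
  F [set t | A t <-> F A].
Proof.
move=> FU; have [FA|FnA] := in_ultra_setVsetC A FU.
  by apply: filterS (FA) => t At; split.
have nFA : ~ F A.
  by move=> FA; have [t []] := filter_ex (filterI FA FnA).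
by apply: filterS FnA => t nAt; split.
Qed.

Lemma ultra_lt_eq T (F : set_system T) (f : T -> nat) k : UltraFilter F ->
  F [set t | (f t < k)%N] -> exists2 v, (v < k)%N & F [set t | f t = v].
Proof.
move=> FU; elim: k => [/filter_ex[]//|k IH fk].
have [fk'|nfk] := pselect (F [set t | f t = k]); first by exists k.
case: IH => [|v vk Fv]; last by exists v => //; exact: leq_trans vk _.
apply: filterS2 fk (ultra_not FU nfk) => t /=.
by rewrite ltnS leq_eqVlt => /orP[/eqP|].
Qed.

Lemma ultra_reprE (I : Type) (D : set_system I) (X : I -> Type)
  (x : ultraprod D X) : sval x = ultra_eq D (ultra_repr x).
Proof. exact: projT2 (cid (svalP x)). Qed.

Lemma ultra_classP (I : Type) (D : set_system I) (X : I -> Type)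
    (f g : forall t, X t) : Filter D ->
  ultra_class D f = ultra_class D g <-> D [set t | f t = g t].
Proof.
move=> FD; split=> [/(congr1 sval)/= e|fg].
  have : ultra_eq D g g by apply: filterS filterT.
  by rewrite -e.
apply: eq_exist; apply/seteqP; split=> h /= hE.
  by apply: filterS2 fg hE => t /= -> ->.
by apply: filterS2 fg hE => t /= -> ->.
Qed.

Lemma ultra_classK (I : Type) (D : set_system I) (X : I -> Type)
  (x : ultraprod D X) : ultra_class D (ultra_repr x) = x.
Proof. by case: x (ultra_reprE x) => C CP /= e; apply: eq_exist. Qed.

Lemma ultra_repr_class (I : Type) (D : set_system I) (X : I -> Type)
    (f : forall t, X t) : Filter D ->
  D [set t | ultra_repr (ultra_class D f) t = f t].
Proof. by move=> FD; apply/ultra_classP; rewrite ultra_classK. Qed.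

(** A point [t] lies in only finitely many of countably many members of a regular family, and [f t]
    bounds the initial segments of indices among them; so [f t] is at least [m] wherever the first
    [m] members meet. *)
Lemma regular_unbounded (L I : Type) (D : set_system I) : Filter D ->
  infinite_set [set: L] -> regular L D ->
  exists f : I -> nat, forall m, D [set t | (m <= f t)%N].
Proof.
move=> FD /infiniteP/card_leT_inj[e eI] [X [DX Xreg]].
pose S t := [set i | X (e i) t].
have Sfin t : finite_set (S t).
  apply: contrapT => Sinf.
  have : (\bigcap_(a in e @` S t) X a) t by move=> _ [i St <-].
  rewrite Xreg // => fin; apply: Sinf.
  by rewrite -(eq_finite_set (inj_card_eq (in2W eI))).
have /choice[f fP] : forall t, exists k, forall m,
    (forall i, (i < m)%N -> S t i) -> (m <= k)%N.
  move=> t; have [k Sk] := (finite_setP (S t)).1 (Sfin t).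
  exists k => m mS; rewrite -(card_le_II) -(card_le_eqr Sk).
  by apply: subset_card_le => i /mS.
exists f => m.
have : D [set t | forall i, i \in iota 0 m -> X (e i) t].
  by apply: filter_forall_in => i _; apply: DX.
apply: filterS => t tX; apply: fP => i im; apply: tX.
by rewrite mem_iota.
Qed.

(** [g t] is the length of the longest initial run of conditions true at [t], capped by [f t] so
    that a maximum exists. *)
Lemma diagonal_unbounded (I : Type) (D : set_system I) (P : nat -> set I) :
  Filter D -> (exists f : I -> nat, forall m, D [set t | (m <= f t)%N]) ->
  (forall m, D (P m)) ->
  exists g : I -> nat, (forall m, D [set t | (m <= g t)%N]) /\
    forall t m, (m < g t)%N -> P m t.
Proof.
move=> FD [f fD] DP.
pose Q t g := (g <= f t)%N && `[< forall m, (m < g)%N -> P m t >].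
have Q0 t : exists g, Q t g by exists 0; apply/andP; split=> //; apply/asboolP.
have Qf t g : Q t g -> (g <= f t)%N by case/andP.
exists (fun t => ex_maxn (Q0 t) (@Qf t)); split=> [m|t m].
  have Dm : D [set t | forall i, i \in iota 0 m -> P i t] by apply: filter_forall_in.
  apply: filterS2 (fD m) Dm => t /= mf mP.
  case: ex_maxnP => g _; apply; apply/andP; split=> //.
  by apply/asboolP => i im; apply: mP; rewrite mem_iota.
by case: ex_maxnP => g /andP[_ /asboolP gP] _; apply: gP.
Qed.

(** If [n t] were at most [k] for [D]-most [t], each class would be determined by its constant value
    modulo [D], leaving only finitely many classes. *)
Lemma nat_ultraprod_unbounded (I : Type) (D : set_system I) (n : I -> nat) k :
  UltraFilter D -> [set: nat] #<= [set: nat_ultraprod D n] ->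
  D [set t | (k < n t)%N].
Proof.
move=> DU inf; apply: contrapT => /(ultra_not DU) Dk.
have {}Dk : D [set t | (n t <= k)%N].
  by apply: filterS Dk => t /= /negP; rewrite -leqNgt.
have val_ex (x : nat_ultraprod D n) :
    exists v : 'I_k.+1, D [set t | ultra_repr x t = v :> nat].
  have [|v vk Dv] := @ultra_lt_eq _ D (fun t => ultra_repr x t : nat) k.+1 DU.
    apply: filterS Dk => t /= ntk.
    by rewrite ltnS (leq_trans _ ntk) // ltnW.
  by exists (Ordinal vk).
have [v vP] := choice val_ex.
suff vI : injective v.
  have [e eI] := card_leT_inj inf.
  suff : (#|'I_k.+2| <= #|'I_k.+1|)%N by rewrite !card_ord ltnn.
  apply: (@leq_card _ _ (fun i : 'I_k.+2 => v (e i))) => i j /vI/eI.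
  exact: val_inj.
move=> x y vxy; rewrite -[x]ultra_classK -[y]ultra_classK.
apply/ultra_classP; apply: filterS2 (vP x) (vP y) => t /= ex ey.
by apply: val_inj; rewrite /= ex ey vxy.
Qed.

Lemma flexible_nat_ultraprod (L I : Type) (D : set_system I) (n : I -> nat) :
  UltraFilter D -> flexible L D ->
  [set: nat] #<= [set: nat_ultraprod D n] ->
  ~ ([set: nat_ultraprod D n] #<= [set: L]).
Proof.
move=> DU flex inf /card_leT_inj[e eI].
(* A representative of any class shows that no [n t] is zero. Hence the predecessor used below is
   strictly smaller, and leaves a value missed by the listed classes active at [t]. *)
have [c0 _] := card_leT_inj inf; pose f0 := ultra_repr (c0 0).
have n_gt0 t : (0 < n t)%N by apply: leq_ltn_trans (ltn_ord (f0 t)).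
have [|X [DX Xn]] := flex (fun t => (n t).-1).
  move=> k; apply: filterS (nat_ultraprod_unbounded k.+1 DU inf) => t /=.
  by rewrite ltn_predRL.
have avoid t : exists h : 'I_(n t), forall x, X (e x) t -> ultra_repr x t <> h.
  apply: contrapT => nh.
  have hit (h : 'I_(n t)) : exists x, X (e x) t /\ ultra_repr x t = h.
    by apply: contra_notP nh => nx; exists h => x Xx xh; apply: nx; exists x.
  have [x xP] := choice hit.
  have [c [ck cI]] := card_le_II_code (Xn t).
  have cx h : (c (e (x h)) < (n t).-1)%N by apply: ck; case: (xP h).
  suff : (#|'I_(n t)| <= #|'I_(n t).-1|)%N.
    by rewrite !card_ord leqNgt ltn_predL n_gt0.
  apply: (@leq_card _ _ (fun h => Ordinal (cx h))) => h h' /(congr1 val)/= ee.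
  have [Xh <-] := xP h; have [Xh' <-] := xP h'.
  by rewrite (eI _ _ (cI _ _ Xh Xh' ee)).
have [h hP] : exists h : forall t, 'I_(n t),
    forall t x, X (e x) t -> ultra_repr x t <> h t.
  by exists (fun t => projT1 (cid (avoid t))) => t; exact: projT2 (cid (avoid t)).
pose x := ultra_class D h.
have [t /= [tX tx]] := filter_ex (filterI (DX (e x)) (@ultra_repr_class _ D _ h _)).
exact: hP tX tx.
Qed.

Lemma nat_ultraprod_infinite (I : Type) (D : set_system I) : UltraFilter D ->
  (exists f : I -> nat, forall m, D [set t | (m <= f t)%N]) ->
  exists n, [set: nat] #<= [set: nat_ultraprod D n].
Proof.
(* Constants give distinct classes: [inord] alters [k] only where [f t < k], a set with [D]-large
   complement. *)
move=> DU [f fD]; exists (fun t => (f t).+1).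
apply: (@inj_card_leT _ _ (fun k => ultra_class D (fun t => inord k : 'I_(f t).+1))).
move=> k l /ultra_classP kl.
have [t /= [[kf lf] e]] := filter_ex (filterI (filterI (fD k) (fD l)) kl).
by rewrite -(@inordK (f t) k) // -(@inordK (f t) l) // e.
Qed.

(** An unbounded function makes some product infinite, so [card_min] has a nonempty family to
    minimise over and [xget] does not fall back on its default. *)
Lemma mu_seqP (I : Type) (D : set_system I) : UltraFilter D ->
  (exists f : I -> nat, forall m, D [set t | (m <= f t)%N]) ->
  is_mu_seq D (mu_seq D).
Proof.
move=> DU /(nat_ultraprod_infinite DU)[n nP].
apply: (@xgetPex _ (fun=> 0) [set n | is_mu_seq D n]).
pose J := {n : I -> nat | [set: nat] #<= [set: nat_ultraprod D n]}.
have [[m mP] mmin] := @card_min J (fun j => nat_ultraprod D (sval j)) (exist _ n nP).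
by exists m; split=> // k kP; apply: (mmin (exist _ k kP)).
Qed.

Lemma flexible_mu (L I : Type) (D : set_system I) : UltraFilter D ->
  (exists f : I -> nat, forall m, D [set t | (m <= f t)%N]) ->
  flexible L D -> card_succ L #<= [set: mu D].
Proof.
move=> DU Dunb flex; have [inf _] := mu_seqP DU Dunb.
have nle := flexible_nat_ultraprod DU flex inf.
have [_] := card_succP L; apply; split=> //.
by case: (card_le_total [set: L] [set: mu D]).
Qed.

(** * Los's theorem *)

Definition tuple_class (L : language) (I : Type) (D : set_system I)
    (M : structure L) n (f : I -> 'I_n -> M) : 'I_n -> ultrapower D M :=
  fun i => ultra_class D (fun t => f t i).

Definition tuple_repr (L : language) (I : Type) (D : set_system I)
    (M : structure L) n (x : 'I_n -> ultrapower D M) : I -> 'I_n -> M :=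
  fun t i => ultra_repr (x i) t.

Lemma tuple_classK (L : language) (I : Type) (D : set_system I)
    (M : structure L) n (x : 'I_n -> ultrapower D M) :
  tuple_class D (tuple_repr x) = x.
Proof. by apply/funext => i; apply: ultra_classK. Qed.

(** Function symbols are interpreted through representatives, which agree with the given functions
    only modulo [D]; as arities are finite, one [D]-large set serves all arguments. *)
Lemma eval_ultrapower (L : language) (I : Type) (D : set_system I)
    (M : structure L) n (f : I -> 'I_n -> M) (u : term L n) : Filter D ->
  eval (tuple_class D f) u = ultra_class D (fun t => eval (f t) u).
Proof.
move=> FD; elim: u => [//|g us IH] /=; apply/ultra_classP.
have : D [set t | forall i,
    ultra_repr (eval (tuple_class D f) (us i)) t = eval (f t) (us i)].
  apply: filter_forall => i; rewrite IH.
  exact: (@ultra_repr_class _ _ (fun=> carrier M)).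
apply: filterS => t tP; congr finterp; exact/funext.
Qed.

Lemma vcons_tuple_class (L : language) (I : Type) (D : set_system I)
    (M : structure L) n (g : I -> M) (f : I -> 'I_n -> M) :
  vcons (ultra_class D g : ultrapower D M) (tuple_class D f) =
  tuple_class D (fun t => vcons (g t) (f t)).
Proof.
by apply/funext => i; rewrite /vcons /tuple_class; case: unlift.
Qed.

Lemma sat_ultrapower (L : language) (I : Type) (D : set_system I)
    (M : structure L) n (phi : formula L n) (f : I -> 'I_n -> M) : UltraFilter D ->
  sat phi (tuple_class D f) <-> D [set t | sat phi (f t)].
Proof.
move=> DU; elim: phi f => {n} /= [n|n u1 u2|n r us|n phi IH1 psi IH2|n phi IH] f.
- by split=> // /filter_ex[].
- by rewrite !eval_ultrapower; apply: (@ultra_classP _ _ (fun=> carrier M)).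
- have rE : D [set t | forall i,
      ultra_repr (eval (tuple_class D f) (us i)) t = eval (f t) (us i)].
    apply: filter_forall => i; rewrite eval_ultrapower.
    exact: (@ultra_repr_class _ _ (fun=> carrier M)).
  by split=> DR; apply: filterS2 rE DR => t /= /funext ->.
- split=> [h|h /IH1 D1].
    have [/IH1/h/IH2|/(ultra_not DU)] := pselect (D [set t | sat phi (f t)]).
      by apply: filterS => t /= psit _.
    by apply: filterS => t nphi /nphi.
  by apply/IH2; apply: filterS2 h D1 => t; apply.
split=> [h|h x].
  apply: contrapT => /(ultra_not DU) Dn.
  have [x0] := carrier_inh M.
  (* A counterexample is chosen at every [t] that has one; the class of [g] then refutes the
     universal formula in the ultrapower. *)
  have /choice[g gP] : forall t, exists x,
      (exists y, ~ sat phi (vcons y (f t))) -> ~ sat phi (vcons x (f t)).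
    move=> t; have [[y ny]|nex] := pselect (exists y, ~ sat phi (vcons y (f t))).
      by exists y.
    by exists x0 => /nex.
  have := h (ultra_class D g); rewrite vcons_tuple_class => /IH Dg.
  have [t /= [nall all]] := filter_ex (filterI Dn Dg).
  apply: nall => y; apply: contrapT => ny; apply: (gP t _ all).
  by exists y.
rewrite -[x]ultra_classK vcons_tuple_class; apply/IH.
by apply: filterS h => t; apply.
Qed.

Lemma sat_vcat_ultrapower (L : language) (I : Type) (D : set_system I)
    (M : structure L) n m (phi : formula L (n + m))
    (f : I -> 'I_n -> M) (g : I -> 'I_m -> M) : UltraFilter D ->
  sat phi (vcat (tuple_class D f) (tuple_class D g)) <->
  D [set t | sat phi (vcat (f t) (g t))].
Proof.
move=> DU; rewrite -(@sat_ultrapower _ _ _ _ _ phi (fun t => vcat (f t) (g t))).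
suff -> : vcat (tuple_class D f) (tuple_class D g) =
  tuple_class D (fun t => vcat (f t) (g t)) by [].
by apply/funext => i; rewrite /vcat /tuple_class; case: fintype.split.
Qed.

Lemma is_model_ultrapower (L : language) (I : Type) (D : set_system I)
    (M : structure L) (T : set (formula L 0)) : UltraFilter D ->
  is_model T M -> is_model T (ultrapower D M).
Proof.
move=> DU MT phi Tphi v; rewrite -[v]tuple_classK; apply/sat_ultrapower.
by apply: filterS filterT => t _; apply: MT.
Qed.

(** * Enumerating formulas *)

Lemma injective_nat_cancel T (c : T -> nat) (x0 : T) : injective c ->
  exists d : nat -> T, cancel c d.
Proof.
move=> cI; have /choice[d dP] : forall k, exists x, (exists y, c y = k) -> c x = k.
  move=> k; have [[y <-]|nex] := pselect (exists y, c y = k); first by exists y.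
  by exists x0 => /nex.
by exists d => x; apply: cI; apply: dP; exists x.
Qed.

Fixpoint term_code (L : language) (cf : Defs.fsym L -> nat) n (u : term L n) :
    GenTree.tree nat :=
  match u with
  | Var i => GenTree.Leaf (i : nat)
  | App f us => GenTree.Node (cf f)
      [seq term_code cf (us i) | i <- enum 'I_(farity f)]
  end.

(** Trees labelled by naturals are countable. Each node records [n], so that the code determines the
    index of the formula as well. *)
Fixpoint formula_code (L : language) (cf : Defs.fsym L -> nat) (cr : rsym L -> nat)
    n (phi : formula L n) : GenTree.tree nat :=
  match phi with
  | Bot n => GenTree.Node 0 [:: GenTree.Leaf n]
  | Eq n u1 u2 => GenTree.Node 1 [:: GenTree.Leaf n; term_code cf u1; term_code cf u2]
  | Rel n r us => GenTree.Node 2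
      [:: GenTree.Leaf n, GenTree.Leaf (cr r) &
          [seq term_code cf (us i) | i <- enum 'I_(rarity r)]]
  | Imp n phi psi => GenTree.Node 3
      [:: GenTree.Leaf n; formula_code cf cr phi; formula_code cf cr psi]
  | All n phi => GenTree.Node 4 [:: GenTree.Leaf n; formula_code cf cr phi]
  end.

Lemma term_code_inj (L : language) (cf : Defs.fsym L -> nat) n :
  injective cf -> injective (term_code (n := n) cf).
Proof.
move=> cfI; elim=> [i|f us IH] [j|g ws] //= [].
  by move=> /val_inj ->.
move=> /cfI efg; case: g / efg ws => ws /eq_in_map e; congr App; apply/funext => i.
by apply: IH; apply: e; rewrite mem_enum.
Qed.

Lemma formula_code_inj (L : language) (cf : Defs.fsym L -> nat) (cr : rsym L -> nat)
    n (phi psi : formula L n) : injective cf -> injective cr ->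
  formula_code cf cr phi = formula_code cf cr psi -> phi = psi.
Proof.
move=> cfI crI phipsi.
(* The indices are allowed to differ, as the two formulas are indexed independently until their
   codes are compared. *)
suff codeI k k' (phi' : formula L k) (psi' : formula L k') :
    formula_code cf cr phi' = formula_code cf cr psi' ->
    existT (formula L) k phi' = existT (formula L) k' psi'.
  exact/existT_inj2/codeI.
elim: phi' k' psi' => {n phi psi phipsi k}
  [n|n u1 u2|n r us|n phi1 IH1 phi2 IH2|n phi IH] n'
  [k|k w1 w2|k s ws|k psi1 psi2|k psi] //= [] e; subst k.
- by [].
- by move=> /(term_code_inj cfI) -> /(term_code_inj cfI) ->.
- move=> /crI ers; case: s / ers ws => ws /eq_in_map e.
  by congr existT; congr Rel; apply/funext => i;
    apply: (term_code_inj cfI); apply: e; rewrite mem_enum.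
- move=> /IH1 e1 /IH2 e2; congr existT; congr Imp;
    exact: existT_inj2.
- move=> /IH e; congr existT; congr All;
    exact: existT_inj2.
Qed.

Lemma formula_enum (L : language) n : countable_language L ->
  exists F : nat -> {m & formula L (n + m)}, forall G, exists j, F j = G.
Proof.
move=> [/countable_injP[cf cfI] /countable_injP[cr crI]].
have {}cfI : injective cf by move=> x y; apply: cfI; rewrite inE.
have {}crI : injective cr by move=> x y; apply: crI; rewrite inE.
pose c (G : {m & formula L (n + m)}) :=
  pickle (tag G, formula_code cf cr (tagged G)).
have [||F FK] := @injective_nat_cancel _ c; last by exists F => G; exists (c G).
  by exists 0; apply: Bot.
move=> [m phi] [k psi] /(pcan_inj pickleK)/= [e]; case: k / e psi => psi e.
by rewrite (formula_code_inj cfI crI e).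
Qed.

(** * Stable theories in ultrapowers *)

Definition fsat (L : language) (M : structure L) n (F : {m & formula L (n + m)})
    (c : 'I_(tag F) -> M) : set ('I_n -> M) :=
  [set x | sat (tagged F) (vcat x c)].

Lemma fsat_ultrapower (L : language) (I : Type) (D : set_system I)
    (M : structure L) n (F : {m & formula L (n + m)})
    (c : I -> 'I_(tag F) -> M) (f : I -> 'I_n -> M) : UltraFilter D ->
  fsat (tuple_class D c) (tuple_class D f) <-> D [set t | fsat (c t) (f t)].
Proof. exact: sat_vcat_ultrapower. Qed.

Lemma fsat_ultrapower_decide (L : language) (I : Type) (D : set_system I)
    (M : structure L) n (F : {m & formula L (n + m)})
    (c : I -> 'I_(tag F) -> M) (f : I -> 'I_n -> M) : UltraFilter D ->
  D [set t | fsat (c t) (f t) <-> fsat (tuple_class D c) (tuple_class D f)].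
Proof.
move=> DU; have := ultra_decide [set t | fsat (c t) (f t)] DU.
apply: filterS => t /= ->; split; by move/fsat_ultrapower.
Qed.

(** Countable saturation of ultraproducts: at [t] one solves as many initial conditions as are
    jointly solvable there, up to a bound that tends to infinity modulo [D]. *)
Lemma internal_saturation (I X : Type) (D : set_system I) (Q : nat -> I -> set X) :
  UltraFilter D -> (exists f : I -> nat, forall m, D [set t | (m <= f t)%N]) ->
  (forall k, D [set t | exists x, forall i, (i < k)%N -> Q i t x]) ->
  exists f : I -> X, forall i, D [set t | Q i t (f t)].
Proof.
move=> DU Dunb DQ; have [g [Dg gP]] := diagonal_unbounded _ Dunb DQ.
have [t0 [x0 _]] := filter_ex (DQ 0).
(* The last index below [g t] is [(g t).-1], which yields a solution of the conditions
   [i < (g t).-1]; if [g t] is zero, any value will do. *)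
have /choice[f fP] : forall t, exists x, forall i, (i.+1 < g t)%N -> Q i t x.
  move=> t; case gt : (g t) => [|k]; first by exists x0.
  by have [|x xP] := gP t k; [rewrite gt|exists x].
by exists f => i; apply: filterS (Dg i.+2) => t; apply: fP.
Qed.

(** The hypothesis on [Q] says that each [R r] is internal; finitely many of them meet because [U]
    is proper, which gives joint solutions in [D]-most factors. *)
Lemma ultrapower_saturation (L : language) (I : Type) (D : set_system I)
    (M : structure L) n (U : set_system ('I_n -> ultrapower D M))
    (R : nat -> set ('I_n -> ultrapower D M)) :
  UltraFilter D -> (exists f : I -> nat, forall m, D [set t | (m <= f t)%N]) ->
  ProperFilter U -> (forall r, U (R r)) ->
  (forall r, exists Q : I -> set ('I_n -> M), forall f,
     R r (tuple_class D f) <-> D [set t | Q t (f t)]) ->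
  exists x, forall r, R r x.
Proof.
move=> DU Dunb UP UR /choice[Q QP].
have [k|f fP] := internal_saturation (Q := Q) DU Dunb.
  have /filter_ex[x xP] : U [set x | forall i, i \in iota 0 k -> R i x].
    by apply: filter_forall_in => i _; apply: UR.
  have : D [set t | forall i, i \in iota 0 k -> Q i t (tuple_repr x t)].
    by apply: filter_forall_in => i /xP; rewrite -{1}[x]tuple_classK => /QP.
  apply: filterS => t tQ; exists (tuple_repr x t) => i ik; apply: tQ.
  by rewrite mem_iota.
by exists (tuple_class D f) => r; apply/QP.
Qed.

Lemma order_property_ultrapower (L : language) (T : set (formula L 0))
    (I : Type) (D : set_system I) (M : structure L) n (F : {m & formula L (n + m)}) :
  UltraFilter D -> (exists f : I -> nat, forall m, D [set t | (m <= f t)%N]) ->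
  is_model T M ->
  (forall k, exists (x : nat -> 'I_n -> ultrapower D M)
      (c : nat -> 'I_(tag F) -> ultrapower D M),
    forall i j, (i < k)%N -> (j < k)%N -> fsat (c j) (x i) <-> (i < j)%N) ->
  order_property T (tagged F).
Proof.
move=> DU Dunb MT fin.
(* The unknown is a pair of whole sequences in the factor; a pair of indices [i], [j] is settled by
   condition [maxn i j]. *)
pose Q k (t : I) (xc : (nat -> 'I_n -> M) * (nat -> 'I_(tag F) -> M)) :=
  forall i j, (i <= k)%N -> (j <= k)%N -> fsat (xc.2 j) (xc.1 i) <-> (i < j)%N.
have [k|f fP] := internal_saturation (Q := Q) DU Dunb.
  have [x [c xcP]] := fin k.
  have : D [set t | forall ij, ij \in [seq (i, j) | i <- iota 0 k, j <- iota 0 k] ->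
      fsat (tuple_repr (c ij.2) t) (tuple_repr (x ij.1) t) <-> (ij.1 < ij.2)%N].
    apply: filter_forall_in => -[i j] /allpairsP[[i' j'] /= []].
    rewrite !mem_iota => /= ik jk [-> ->].
    have := fsat_ultrapower_decide (tuple_repr (c j')) (tuple_repr (x i')) DU.
    by rewrite !tuple_classK; apply: filterS => t /= ->; apply: xcP.
  apply: filterS => t tP.
  exists (fun i => tuple_repr (x i) t, fun j => tuple_repr (c j) t).
  move=> l lk i j il jl; apply: (tP (i, j)).
  by apply/allpairsP; exists (i, j); rewrite !mem_iota /= !(leq_ltn_trans _ lk).
exists (ultrapower D M); split; first exact: is_model_ultrapower.
exists (fun i => tuple_class D (fun t => (f t).1 i)).
exists (fun j => tuple_class D (fun t => (f t).2 j)) => i j.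
have [t [tP tQ]] := filter_ex (filterI (fP (maxn i j))
  (fsat_ultrapower_decide (fun t => (f t).2 j) (fun t => (f t).1 i) DU)).
apply: iff_trans (iff_sym tQ) _.
by apply: tP; rewrite ?leq_maxl ?leq_maxr.
Qed.

(* [b i] realises [U] over parameters [w F s] chosen for the finite sequences [s]
   of earlier terms: if some instance of [F] in [U] fails on all of [s], then the
   instance at [w F s] is such an instance. *)
Lemma ultrafilter_sequence (L : language) (I : Type) (D : set_system I)
    (M : structure L) n (U : set_system ('I_n -> ultrapower D M)) :
  countable_language L ->
  UltraFilter D -> (exists f : I -> nat, forall m, D [set t | (m <= f t)%N]) ->
  ProperFilter U ->
  exists (b : nat -> 'I_n -> ultrapower D M)
    (w : forall F : {m & formula L (n + m)},
      seq ('I_n -> ultrapower D M) -> 'I_(tag F) -> ultrapower D M),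
    (forall F s (c : 'I_(tag F) -> ultrapower D M),
      U (fsat c) -> all (fun x => `[< ~ fsat c x >]) s ->
      U (fsat (w F s)) /\ all (fun x => `[< ~ fsat (w F s) x >]) s) /\
    (forall F (l : seq nat) i, (forall j, j \in l -> (j < i)%N) ->
      U (fsat (w F (map b l))) -> fsat (w F (map b l)) (b i)).
Proof.
move=> Lc DU Dunb UP; have [F FP] := formula_enum n Lc.
set N := ultrapower D M; have [y0] := carrier_inh N.
pose good (G : {m & formula L (n + m)}) s (c : 'I_(tag G) -> N) :=
  U (fsat c) /\ all (fun x => `[< ~ fsat c x >]) s.
have w_ex G s : {c | (exists c', @good G s c') -> @good G s c}.
  apply: cid; have [[c cP]|nc] := pselect (exists c, @good G s c).
    by exists c.
  by exists (fun=> y0) => /nc.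
pose w G s := sval (w_ex G s).
have wP G s (c : 'I_(tag G) -> N) : U (fsat c) ->
    all (fun x => `[< ~ fsat c x >]) s -> good G s (w G s).
  by move=> Uc sc; apply: (svalP (w_ex G s)); exists c.
pose x0 : 'I_n -> N := fun=> y0.
have /choice[nx nxP] : forall s, exists x, forall G (l : seq nat),
    U (fsat (w G (map (nth x0 s) l))) -> fsat (w G (map (nth x0 s) l)) x.
  move=> s.
  (* A code [r] names a formula and a list of positions in [s], so countably many conditions
     suffice. Codes of no pair, and instances outside [U], impose nothing. *)
  pose R r : set ('I_n -> N) :=
    if unpickle r is Some (j, l) then
      if `[< U (fsat (w (F j) (map (nth x0 s) l))) >]
      then fsat (w (F j) (map (nth x0 s) l)) else setT
    else setT.
  have [r|r|x xP] := ultrapower_saturation (R := R) DU Dunb UP.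
  - rewrite /R; case: unpickle => [[j l]|]; last exact: filterT.
    by case: asboolP => // _; apply: filterT.
  - have intT : exists Q : I -> set ('I_n -> M), forall f : I -> 'I_n -> M,
        (setT : set ('I_n -> N)) (tuple_class D f) <-> D [set t | Q t (f t)].
      by exists (fun=> setT) => f; split=> // _; apply: filterS filterT.
    rewrite /R; case: unpickle => [[j l]|//]; case: asboolP => // _.
    exists (fun t => fsat (tuple_repr (w (F j) (map (nth x0 s) l)) t)) => f.
    by rewrite -fsat_ultrapower tuple_classK.
  exists x => G l; have [j <-] := FP G; have := xP (pickle (j, l)).
  by rewrite /R pickleK; case: asboolP.
(* [pre k] lists the first [k] terms, so positions in [pre i] are the indices of the earlier
   terms. *)
pose pre k := iter k (fun s => rcons s (nx s)) [::].
pose b i := nx (pre i).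
have preE k : pre k = mkseq b k by elim: k => // k IH; rewrite mkseqS -IH.
exists b, w; split=> [G s c|G l i li]; first exact: wP.
suff -> : map b l = map (nth x0 (pre i)) l by apply: nxP.
by apply/eq_in_map => j /li ji; rewrite preE nth_mkseq.
Qed.

(* If the instances in [U] failed on arbitrarily many terms, the chosen parameters
   along the failing terms would exhibit the order property. *)
Lemma stable_sequence_bound (L : language) (T : set (formula L 0))
    (I : Type) (D : set_system I) (M : structure L) n
    (U : set_system ('I_n -> ultrapower D M))
    (b : nat -> 'I_n -> ultrapower D M)
    (w : forall F : {m & formula L (n + m)},
      seq ('I_n -> ultrapower D M) -> 'I_(tag F) -> ultrapower D M) :
  UltraFilter D -> (exists f : I -> nat, forall m, D [set t | (m <= f t)%N]) ->
  stable T -> is_model T M ->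
  (forall F s (c : 'I_(tag F) -> ultrapower D M),
    U (fsat c) -> all (fun x => `[< ~ fsat c x >]) s ->
    U (fsat (w F s)) /\ all (fun x => `[< ~ fsat (w F s) x >]) s) ->
  (forall F (l : seq nat) i, (forall j, j \in l -> (j < i)%N) ->
    U (fsat (w F (map b l))) -> fsat (w F (map b l)) (b i)) ->
  forall F, exists k, forall (c : 'I_(tag F) -> ultrapower D M) m, U (fsat c) ->
    (count (fun i => `[< ~ fsat c (b i) >]) (iota 0 m) <= k)%N.
Proof.
move=> DU Dunb Tst MT wP bP F; apply: contrapT => nk.
apply: (Tst _ _ (tagged F)); apply: (order_property_ultrapower DU Dunb MT) => k.
have [c [m [Uc km]]] : exists c m, U (fsat c) /\
    (k < count (fun i => `[< ~ fsat (c : 'I_(tag F) -> _) (b i) >]) (iota 0 m))%N.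
  apply: contrapT => nc; apply: nk; exists k => c m Uc; rewrite leqNgt.
  by apply/negP => km; apply: nc; exists c, m.
pose l := [seq i <- iota 0 m | `[< ~ fsat c (b i) >]].
have kl : (k < size l)%N by rewrite size_filter.
have lsort : sorted ltn l.
  by apply: sorted_filter (iota_ltn_sorted 0 m); apply: ltn_trans.
(* The instance at [v r] fails at the first [r.+1] terms listed by [l], the parameters [c] showing
   that such a choice exists in [U]; it holds at the later ones, which satisfy the instances in [U]
   chosen for earlier terms. *)
pose v r := w F (map b (take r.+1 l)).
have [vU vn] : (forall r, U (fsat (v r))) /\
    (forall r r', (r' <= r)%N -> (r' < k)%N -> ~ fsat (v r) (b (nth 0 l r'))).
  have vP r : U (fsat (v r)) /\
      all (fun x => `[< ~ fsat (v r) x >]) (map b (take r.+1 l)).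
    apply: (wP _ _ c) => //; rewrite all_map; apply/allP => i /mem_take.
    by rewrite mem_filter => /andP[].
  split=> [r|r r' rr rk]; first by case: (vP r).
  have [_] := vP r; rewrite all_map => /allP /(_ (nth 0 l r')) /= h.
  apply/asboolP/h; rewrite -(@nth_take r.+1) ?ltnS //; apply: mem_nth.
  by rewrite size_take; case: ifP => // _; apply: ltn_trans kl.
have vy r r' : (r < r')%N -> (r' < k)%N -> fsat (v r) (b (nth 0 l r')).
  move=> rr rk; apply: bP (vU r) => j /(nthP 0)[i].
  rewrite size_take => il <-.
  have ir : (i <= r)%N.
    rewrite -ltnS; move: il; case: ifP => // /negbT.
    by rewrite -leqNgt => /[swap]; apply: leq_trans.
  rewrite nth_take ?ltnS //; apply: (sorted_ltn_nth ltn_trans) => //; rewrite ?inE.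
  - exact: leq_ltn_trans ir (ltn_trans rr (ltn_trans rk kl)).
  - exact: ltn_trans rk kl.
  - exact: leq_ltn_trans rr.
(* For indices below [k], the instance at [v r] holds at the term numbered [r'] in [l] exactly when
   [r < r']; reversing both indices turns this into [i < j]. *)
exists (fun i => b (nth 0 l (k.-1 - i))), (fun j => v (k.-1 - j)) => i j ik jk.
have k1 r : (k.-1 - r < k)%N.
  by rewrite (leq_ltn_trans (leq_subr _ _)) // ltn_predL (leq_trans _ ik).
split=> [h|ij].
  rewrite ltnNge; apply/negP => ji; apply: vn h => //; exact: leq_sub2l.
apply: vy => //; apply: ltn_sub2l => //.
by rewrite -ltnS prednK ?(leq_ltn_trans _ ij) // (leq_trans _ jk) // ltnS.
Qed.

(** * Saturation *)

Lemma card_set_count n (P : pred nat) :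
  #|[set i : 'I_n | P i]%SET| = count P (iota 0 n).
Proof.
rewrite -sum1_count -[n in iota 0 n]subn0 big_mkord -sum1_card.
by apply: eq_bigl => i; rewrite inE.
Qed.

Lemma card_bigcup_leq (J T : finType) (P : pred J) (B : J -> {set T}) :
  (#|\bigcup_(j | P j) B j|%SET <= \sum_(j | P j) #|B j|)%N.
Proof.
elim/big_rec2: _ => [|j k S _ Sk]; first by rewrite cards0.
by rewrite (leq_trans (leq_card_setU _ _)) // leq_add2l.
Qed.

(** A union bound: the at most [h] elements of [u] form at most [h ^ m j] tuples for each [j], and
    each tuple considered rules out at most [k j] positions, so fewer than [n] positions are
    lost. *)
Lemma avoid_small_events (h n : nat) (m k : nat -> nat) (A : Type) (u : set A)
    (E : forall j, ('I_(m j) -> A) -> nat -> Prop) :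
  u #<= `I_h -> (\sum_(j < h) h ^ m j * k j < n)%N ->
  exists i, forall j (a : 'I_(m j) -> A), (j < h)%N -> (forall l, u (a l)) ->
    (count (fun i => `[< E j a i >]) (iota 0 n) <= k j)%N -> ~ E j a i.
Proof.
move=> /card_le_II_code[c [ch cI]] sum_lt.
(* Tuples are indexed by their codes [g], which range over a finite type even if [A] is infinite; a
   code belongs to at most one tuple. *)
pose inst j (g : {ffun 'I_(m j) -> 'I_h}) (a : 'I_(m j) -> A) :=
  [/\ forall l, u (a l), forall l, c (a l) = g l :> nat
    & (count (fun i => `[< E j a i >]) (iota 0 n) <= k j)%N].
have inst_eq j g a a' : @inst j g a -> @inst j g a' -> a = a'.
  move=> [ua ag _] [ua' ag' _]; apply/funext => l; apply: cI => //.
  by rewrite ag ag'.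
pose bad (j : 'I_h) g : {set 'I_n} :=
  [set i : 'I_n | `[< exists a, @inst j g a /\ E j a i >]]%SET.
have bad_le j g : (#|bad j g| <= k j)%N.
  have [[a ag]|na] := pselect (exists a, @inst j g a).
    have [_ _ cnt] := ag; apply: leq_trans cnt; rewrite -card_set_count.
    apply/subset_leq_card/fintype.subsetP => i; rewrite !inE => -[a' [a'g Ei]].
    by rewrite (inst_eq _ _ _ _ ag a'g).
  suff -> : bad j g = finset.set0 by rewrite cards0.
  apply/eqP; rewrite -finset.subset0; apply/fintype.subsetP => i.
  by rewrite !inE => -[a [ag _]]; case: na; exists a.
pose allbad := (\bigcup_j \bigcup_g bad j g)%SET.
have /subsetPn[i _ iP] : ~~ ([set: 'I_n]%SET \subset allbad).
  apply: contraTN sum_lt => /subset_leq_card; rewrite cardsT card_ord -leqNgt => nb.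
  apply: leq_trans nb _; apply: leq_trans (card_bigcup_leq _ _) _.
  apply: leq_sum => j _; apply: leq_trans (card_bigcup_leq _ _) _.
  apply: leq_trans (leq_sum _ (fun g _ => bad_le j g)) _.
  by rewrite sum_nat_const card_ffun !card_ord.
exists i => j a jh ua cnt Ei; move/negP: iP; apply.
apply/finset.bigcupP; exists (Ordinal jh) => //.
apply/finset.bigcupP; exists [ffun l => Ordinal (ch _ (ua l))] => //.
rewrite finset.inE; apply/asboolP; exists a; split=> //; split=> // l.
by rewrite ffunE.
Qed.

(** The sets containing all solutions of some finite part of [p] form a proper filter, which extends
    to an ultrafilter. *)
Lemma finitely_satisfiable_ultrafilter (L : language) (N : structure L)
    (A : set N) n (p : set (pformula A n)) :
  (forall q, finite_set q -> q `<=` p ->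
    exists a : 'I_n -> N, forall phi, q phi -> psat phi a) ->
  exists U : set_system ('I_n -> N), UltraFilter U /\
    forall phi, p phi -> U [set a | psat phi a].
Proof.
move=> pfin.
pose F (B : set ('I_n -> N)) := exists q, [/\ finite_set q, q `<=` p
  & forall a, (forall phi, q phi -> psat phi a) -> B a].
have FF : Filter F.
  split=> [|B C [q [qf qp qB]] [r [rf rp rC]]|B C BC [q [qf qp qB]]].
  - by exists set0; split=> //; apply: finite_set0.
  - exists (q `|` r); split; first by rewrite finite_setU.
      by move=> phi [/qp|/rp].
    move=> a aqr; split; [apply: qB|apply: rC] => phi phi_in; apply: aqr.
      by left.
    by right.
  - by exists q; split=> // a /qB/BC.
have FP : ProperFilter F.
  split=> // -[q [qf qp q0]].
  by have [a /q0] := pfin q qf qp.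
have [U [UU FU]] := ultraFilterLemma FP.
exists U; split=> // phi pphi; apply: FU; exists [set phi]; split.
- exact: finite_set1.
- by move=> _ ->.
- by move=> a; apply.
Qed.

(** Bounding the positions by [m] keeps this within the reach of Los's theorem, which passes it to
    the factors for all parameters there at once. *)
Definition few_exceptions (L : language) (M : structure L) n
    (F : {m & formula L (n + m)}) (k m : nat) (b : nat -> 'I_n -> M) : Prop :=
  forall c : 'I_(tag F) -> M,
    (count (fun i => `[< ~ fsat c (b i) >]) (iota 0 m) <= k)%N \/
    (count (fun i => `[< fsat c (b i) >]) (iota 0 m) <= k)%N.

Lemma stable_type_sequence (L : language) (T : set (formula L 0))
    (I : Type) (D : set_system I) (M : structure L)
    (A : set (ultrapower D M)) n (p : set (pformula A n)) :
  countable_language L -> UltraFilter D ->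
  (exists f : I -> nat, forall m, D [set t | (m <= f t)%N]) ->
  stable T -> is_model T M -> complete_type p ->
  exists (b : nat -> 'I_n -> ultrapower D M)
    (k : {m & formula L (n + m)} -> nat),
    (forall F m, few_exceptions F (k F) m b) /\
    (forall phi m, p phi ->
      (count (fun i => `[< ~ psat phi (b i) >]) (iota 0 m)
        <= k (existT _ _ (pf_formula phi)))%N).
Proof.
move=> Lc DU Dunb Tst MT [/finitely_satisfiable_ultrafilter[U [UU pU]] _].
have [b [w [wP bP]]] :=
  ultrafilter_sequence Lc DU Dunb (ultra_proper (UltraFilter := UU)).
have [k kP] := choice (stable_sequence_bound DU Dunb Tst MT wP bP).
(* Either an instance of [F] or its negation lies in [U] and so fails rarely; adding the two bounds
   covers both cases. *)
pose ng (F : {m & formula L (n + m)}) : {m & formula L (n + m)} :=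
  existT _ (tag F) (Neg (tagged F)).
exists b, (fun F => k F + k (ng F))%N; split=> [F m c|phi m pphi]; last first.
  apply: leq_trans (leq_addr _ _).
  apply: (kP (existT _ _ (pf_formula phi))); exact: pU.
have [Uc|nUc] := in_ultra_setVsetC (fsat c) UU.
  by left; apply: leq_trans (leq_addr _ _); apply: kP.
right; apply: leq_trans (leq_addl _ _).
apply: leq_trans (kP (ng F) c m nUc); apply: sub_count => i /asboolP ci.
by apply/asboolP => /(_ ci).
Qed.

Lemma few_exceptions_ultrapower (L : language) (I : Type) (D : set_system I)
    (M : structure L) n (F : {m & formula L (n + m)}) k m
    (b : nat -> 'I_n -> ultrapower D M) : UltraFilter D ->
  few_exceptions F k m b ->
  D [set t | few_exceptions F k m (fun i => tuple_repr (b i) t)].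
Proof.
move=> DU Fb; apply: contrapT => /(ultra_not DU) Dn.
have [x0] := carrier_inh M.
pose small t (c : 'I_(tag F) -> M) :=
  (count (fun i => `[< ~ fsat c (tuple_repr (b i) t) >]) (iota 0 m) <= k)%N \/
  (count (fun i => `[< fsat c (tuple_repr (b i) t) >]) (iota 0 m) <= k)%N.
(* Violating parameters are chosen wherever there are any; their class would violate the bound in
   the ultrapower. *)
have /choice[c cP] : forall t, exists c, (exists c', ~ small t c') -> ~ small t c.
  move=> t; have [[c nc]|nex] := pselect (exists c', ~ small t c').
    by exists c.
  by exists (fun=> x0) => /nex.
have Dc : D [set t | forall i, i \in iota 0 m ->
    fsat (c t) (tuple_repr (b i) t) <-> fsat (tuple_class D c) (b i)].
  apply: filter_forall_in => i _.
  by have := fsat_ultrapower_decide c (tuple_repr (b i)) DU; rewrite tuple_classK.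
have [t /= [nsm tc]] := filter_ex (filterI Dn Dc).
apply: nsm => c0; apply: contrapT => nc0; apply: (cP t); first by exists c0.
have := Fb (tuple_class D c); rewrite /small.
have -> : count (fun i => `[< fsat (c t) (tuple_repr (b i) t) >]) (iota 0 m) =
          count (fun i => `[< fsat (tuple_class D c) (b i) >]) (iota 0 m).
  by apply: eq_in_count => i /tc h; apply: asbool_equiv_eq.
suff -> : count (fun i => `[< ~ fsat (c t) (tuple_repr (b i) t) >]) (iota 0 m) =
          count (fun i => `[< ~ fsat (tuple_class D c) (b i) >]) (iota 0 m) by [].
by apply: eq_in_count => i /tc h; apply: asbool_equiv_eq; rewrite h.
Qed.

Lemma flexible_stable_saturated (lambda I : Type) (D : set_system I)
    (L : language) (T : set (formula L 0)) (M : structure L) :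
  UltraFilter D -> (exists f : I -> nat, forall m, D [set t | (m <= f t)%N]) ->
  flexible lambda D -> countable_language L -> stable T -> is_model T M ->
  saturated (card_succ lambda) (ultrapower D M).
Proof.
move=> DU Dunb flex Lc Tst MT A /lt_card_succP Ale n p ptype.
have [b [k [bk pk]]] := stable_type_sequence Lc DU Dunb Tst MT ptype.
have [F FP] := formula_enum n Lc.
pose B i t := tuple_repr (b i) t.
pose kF j := k (F j); pose mF j := tag (F j).
(* [H h] bounds the positions lost to the first [h] formulas with parameters among [h] elements. In
   [len], the successor leaves a position over and the summand [h] makes the length unbounded modulo
   [D]. *)
pose H h := (\sum_(j < h) h ^ mF j * kF j)%N.
pose len h := (H h + h).+1.
pose P h := [set t | forall j, j \in iota 0 h ->
  few_exceptions (F j) (kF j) (len h) (fun i => B i t)].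
have [h'|g [Dg gP]] := @diagonal_unbounded _ D P _ Dunb.
  by apply: filter_forall_in => j _; apply: few_exceptions_ultrapower.
(* [gP] covers indices strictly below [g t], so the predecessor makes [P (h t)] available at [t]
   wherever [g t] is positive. *)
pose h t := (g t).-1.
have Dh m : D [set t | (m < h t)%N].
  by apply: filterS (Dg m.+2) => t /= mg; rewrite /h ltn_predRL.
have [X [DX Xh]] := flex h Dh.
have [e eI] : exists e : A -> lambda, injective e.
  by apply: card_leT_inj; rewrite (card_le_eql (card_setT A)).
pose u t := [set a : A | X (e a) t].
have uh t : u t #<= `I_(h t).
  apply: card_le_trans (Xh t); rewrite -(card_le_eql (inj_card_eq (in2W eI))).
  by apply: subset_card_le => _ [a ua <-].
pose E t j (a : 'I_(mF j) -> A) i := ~ fsat (fun l => ultra_repr (val (a l)) t) (B i t).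
have /choice[s sP] t := avoid_small_events (E t) (uh t)
  (leq_addr (h t) (H (h t)).+1 : H (h t) < len (h t))%N.
exists (tuple_class D (fun t => B (s t) t)) => phi pphi.
pose G : {m & formula L (n + m)} := existT _ _ (pf_formula phi).
pose a : 'I_(tag G) -> A := pf_params (p := phi).
pose c : 'I_(tag G) -> ultrapower D M := fun l => val (a l).
change (fsat c (tuple_class D (fun t => B (s t) t))).
rewrite -[c]tuple_classK; apply/fsat_ultrapower.
(* The instance fails at no more than [k G] of the [b i], so among the first [r] it holds at more
   than [k G]. *)
have [j jG] := FP G; pose r := (k G).*2.+1.
have Da : D [set t | forall l, X (e (a l)) t] by apply: filter_forall => l.
have Dr : D [set t | forall i, i \in iota 0 r ->
    fsat (tuple_repr c t) (B i t) <-> fsat c (b i)].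
  apply: filter_forall_in => i _.
  have := fsat_ultrapower_decide (tuple_repr c) (tuple_repr (b i)) DU.
  by rewrite !tuple_classK.
apply: filterS3 (filterI (Dh j) (Dh r)) Da Dr => t [jh rh] ta tr.
have gt : (h t < g t)%N by move: jh; rewrite /h /=; case: (g t).
have jt : few_exceptions G (k G) (len (h t)) (fun i => B i t).
  by have := gP t (h t) gt j; rewrite mem_iota /kF jG => /(_ jh).
(* The parameters are generalised because their type depends on [G], which has to be rewritten into
   [F j]. *)
have st (d : 'I_(tag G) -> A) : (forall l, u t (d l)) ->
    (count (fun i => `[< ~ fsat (fun l => ultra_repr (val (d l)) t) (B i t) >])
      (iota 0 (len (h t))) <= k G)%N ->
    fsat (fun l => ultra_repr (val (d l)) t) (B (s t) t).
  move: d; rewrite -jG => d du dk.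
  apply: contrapT; exact: sP jh du dk.
(* That the instance holds rarely in the factor is refuted on the first [r] positions, which lie
   within the length. *)
apply: (st a ta); case: (jt (tuple_repr c t)) => //; rewrite leqNgt => /negP[].
have -> : len (h t) = (r + (len (h t) - r))%N.
  by rewrite subnKC // /len ltnW // ltnS (leq_trans (ltnW rh)) // leq_addl.
rewrite iotaD count_cat; apply: leq_trans (leq_addr _ _).
have := pk phi r pphi; rewrite -/G.
have -> : count (fun i => `[< fsat (tuple_repr c t) (B i t) >]) (iota 0 r) =
          count (fun i => `[< psat phi (b i) >]) (iota 0 r).
  by apply: eq_in_count => i /tr h1; apply: asbool_equiv_eq.
have := count_predC (fun i => `[< psat phi (b i) >]) (iota 0 r).
rewrite size_iota (@eq_count _ (predC _) (fun i => `[< ~ psat phi (b i) >]));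
  last first.
  by move=> i /=; rewrite asbool_neg.
move=> cntE le; have {}cntE := etrans cntE (erefl (k G).*2.+1).
by rewrite -(leq_add2r (k G)) addSn addnn -cntE leq_add2l.
Qed.

Theorem mainTheorem2 (lambda I : Type) (D : set_system I)
    (lambda_infinite : infinite_set [set: lambda])
    (card_I : [set: I] #= [set: lambda])
    (D_ultra : UltraFilter D)
    (D_regular : regular lambda D)
    (D_flexible : flexible lambda D) :
  card_succ lambda #<= [set: mu D] /\
  forall (L : language) (T : set (formula L 0)),
    countable_language L -> complete_theory T -> stable T ->
    forall M : structure L, is_model T M ->
      saturated (card_succ lambda) (ultrapower D M).
Proof.
have Dunb := regular_unbounded (@ultra_proper _ D D_ultra) lambda_infinite D_regular.
split=> [|L T Lc _ Tst M MT]; first exact: flexible_mu.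
exact: flexible_stable_saturated Tst MT.
Qed.
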